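(* The isomorphism problem for 4-multipedes with shoes (given a pair of 4-multipedes with shoes as a single 6-sorted structure, decide whether they are isomorphic) is not definable in $C^\omega_{\infty,\omega}$, and therefore not in FP+Card.
   Context: A 2-multipede is a finite 2-sorted structure with sorts ''segments'' and ''feet'', a function $S$ from feet to segments such that every segment is the image of exactly two feet, a family of 3-element sets of segments called hyperedges (coded as a totally irreflexive symmetric ternary relation), and a family of 3-element sets of feet called positive triples (similarly coded), such that: if $P$ is a positive triple then $S(P)$ is a hyperedge; for each hyperedge $H$, exactly four of the eight triples of feet mapped by $S$ onto $H$ are positive; and if $P,P'$ are positive with $S(P)=S(P')$ then $|P\triangle P'|$ is even. A 3-multipede is a 2-multipede with a linear ordering $\le$ of the segments. A 4-multipede is a 3-multipede with a third sort ''sets'' and a binary relation $\varepsilon$ between segments and sets such that every set of segments equals $\{s:s\,\varepsilon\,x\}$ for a unique element $x$ of the sort of sets. A multipede with a shoe is a multipede with a distinguished foot (the shoe) with $S$ of the shoe the $\le$-first segment. $C^\omega_{\infty,\omega}$ is infinitary logic (arbitrary conjunctions and disjunctions) in which each formula uses finitely many variables, extended with counting quantifiers $\exists^{\ge m}$ (''for at least $m$ values''). FP+Card is fixpoint logic with counting (inflationary fixpoints over a two-sorted extension of the structure by the numbers $0,\dots,|A|$ with successor, plus counting terms $(\sharp x)\varphi(x)$); every FP+Card-definable query is $C^\omega_{\infty,\omega}$-definable. *)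

(* Defs.v *)
(* Mathematical Components; no classical axioms are needed to state anything. *)
From HB Require Import structures.
From mathcomp Require Import all_boot.

Set Implicit Arguments.
Unset Strict Implicit.
Unset Printing Implicit Defensive.

(** * Many-sorted vocabularies and finite structures *)

Record signature := Signature {
  sort : finType;
  func : Type;
  farity : func -> nat;
  fdom : forall f : func, 'I_(farity f) -> sort;
  fcod : func -> sort;
  rsym : Type;
  rarity : rsym -> nat;
  rdom : forall r : rsym, 'I_(rarity r) -> sort
}.

Arguments fdom {s f} _.
Arguments rdom {s r} _.

Record structure (sg : signature) := Structure {
  dom : sort sg -> finType;
  dom_gt0 : forall s, 0 < #|dom s|;
  fun_int : forall f : func sg,
    (forall k : 'I_(farity f), dom (fdom k)) -> dom (fcod f);
  rel_int : forall r : rsym sg,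
    (forall k : 'I_(rarity r), dom (rdom k)) -> bool
}.

Definition isomorphic (sg : signature) (A B : structure sg) : Prop :=
  exists h : forall s, dom A s -> dom B s,
    [/\ forall s, bijective (h s),
        forall (f : func sg) (a : forall k : 'I_(farity f), dom A (fdom k)),
          h (fcod f) (fun_int a) = fun_int (fun k => h (fdom k) (a k))
      & forall (r : rsym sg) (a : forall k : 'I_(rarity r), dom A (rdom k)),
          rel_int (fun k => h (rdom k) (a k)) = rel_int a].

(* Two structures with n sorts as one structure with 2n sorts, over two disjoint
   copies of the vocabulary: the tag [false] marks the first structure and
   [true] the second one. *)
Definition pair_sig (sg : signature) : signature :=
  @Signature (bool * sort sg)%type
    (bool * func sg)%type (fun f => farity f.2)
    (fun f k => (f.1, fdom k)) (fun f => (f.1, fcod f.2))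
    (bool * rsym sg)%type (fun r => rarity r.2)
    (fun r k => (r.1, rdom k)).

Definition pair_structure (sg : signature) (A B : structure sg) :
    structure (pair_sig sg) :=
  let C (b : bool) := if b then B else A in
  @Structure (pair_sig sg)
    (fun s => dom (C s.1) s.2)
    (fun s => dom_gt0 (C s.1) s.2)
    (fun f a => @fun_int sg (C f.1) f.2 a)
    (fun r a => @rel_int sg (C r.1) r.2 a).

(** * The logic C^omega_{infinity,omega} *)

(* [cform sg k] consists of the formulas whose variables, free or bound, are
   among the variables x_0, ..., x_(k-1) of each sort. There are finitely many
   sorts, so a formula of the infinitary logic has finitely many variables iff
   it belongs to [cform sg k] for some k. *)
Definition cvar (sg : signature) (k : nat) : eqType := (sort sg * 'I_k)%type.

Inductive cterm (sg : signature) (k : nat) : sort sg -> Type :=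
| CVar (v : cvar sg k) : cterm k v.1
| CApp (f : func sg) (t : forall i : 'I_(farity f), cterm k (fdom i)) :
    cterm k (fcod f).

(* [CAtLeast m v phi] is the counting quantifier "for at least m values of v";
   "exists" is the case m = 1, and "for all" is obtained by negation. *)
Inductive cform (sg : signature) (k : nat) : Type :=
| CEq (s : sort sg) (t1 t2 : cterm k s)
| CRel (r : rsym sg) (t : forall i : 'I_(rarity r), cterm k (rdom i))
| CNot (phi : cform sg k)
| CConj (I : Type) (phi : I -> cform sg k)
| CDisj (I : Type) (phi : I -> cform sg k)
| CAtLeast (m : nat) (v : cvar sg k) (phi : cform sg k).

Definition cassign (sg : signature) (M : structure sg) (k : nat) : Type :=
  forall v : cvar sg k, dom M v.1.

Fixpoint cteval (sg : signature) (M : structure sg) (k : nat)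
    (e : cassign M k) (s : sort sg) (t : cterm k s) {struct t} : dom M s :=
  match t with
  | CVar v => e v
  | CApp f t => fun_int (fun i => cteval e (t i))
  end.

Fixpoint csat (sg : signature) (M : structure sg) (k : nat)
    (e : cassign M k) (phi : cform sg k) {struct phi} : Prop :=
  match phi with
  | CEq s t1 t2 => cteval e t1 = cteval e t2
  | CRel r t => rel_int (fun i => cteval e (t i))
  | CNot phi => ~ csat e phi
  | CConj J phi => forall i : J, csat e (phi i)
  | CDisj J phi => exists i : J, csat e (phi i)
  | CAtLeast m v phi => exists2 A : {set dom M v.1},
      m <= #|A| & forall a, a \in A -> csat (dfwith e a) phi
  end.

Fixpoint ctfree (sg : signature) (k : nat) (v : cvar sg k)
    (s : sort sg) (t : cterm k s) {struct t} : Prop :=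
  match t with
  | CVar w => v = w
  | CApp f t => exists i, ctfree v (t i)
  end.

Fixpoint cfree (sg : signature) (k : nat) (v : cvar sg k)
    (phi : cform sg k) {struct phi} : Prop :=
  match phi with
  | CEq s t1 t2 => ctfree v t1 \/ ctfree v t2
  | CRel r t => exists i, ctfree v (t i)
  | CNot phi => cfree v phi
  | CConj J phi => exists i : J, cfree v (phi i)
  | CDisj J phi => exists i : J, cfree v (phi i)
  | CAtLeast m w phi => v <> w /\ cfree v phi
  end.

Definition csentence (sg : signature) (k : nat) (phi : cform sg k) : Prop :=
  forall v, ~ cfree v phi.

Definition cmodels (sg : signature) (M : structure sg) (k : nat)
    (phi : cform sg k) : Prop :=
  forall e : cassign M k, csat e phi.

(* A decision problem is given by its instances [i : I], the structures [str i]
   that encode them, and the set [Q] of its positive instances. *)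
Definition Comega_definable (sg : signature) (I : Type)
    (str : I -> structure sg) (Q : I -> Prop) : Prop :=
  exists (k : nat) (phi : cform sg k),
    csentence phi /\ forall i, cmodels (str i) phi <-> Q i.

(** * The logic FP+Card *)

(* The sorts of the extended structure are [Some s] for the sorts s of the
   original one, and [None] for the numbers 0, ..., |A|, where |A| is the
   total number of elements, of all sorts. *)
Definition size_of (sg : signature) (M : structure sg) : nat :=
  \sum_(s : sort sg) #|dom M s|.

Definition xdom (sg : signature) (M : structure sg) (s : option (sort sg)) :
    finType :=
  if s is Some s then dom M s else 'I_(size_of M).+1.

Definition fvar (sg : signature) : eqType := (option (sort sg) * nat)%type.

(* A relation variable consists of a name and of the list of the sorts of its
   arguments. *)
Definition frvar (sg : signature) : eqType :=
  (nat * seq (option (sort sg)))%type.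

Definition nth_sort (T : Type) (a : seq T) (i : 'I_(size a)) : T :=
  tnth (in_tuple a) i.
Arguments nth_sort {T a} i.

(* [FCount s x phi] is the counting term (# x) phi, where x is the variable
   [(Some s, x)]. [FIfp X a xs _ phi t] is the formula
   [IFP X, x_1 ... x_n . phi](t_1, ..., t_n), where X is the relation variable
   [(X, a)], n = size a, and x_i is the variable with the i-th sort of a and
   the i-th name of xs. *)
Inductive fterm (sg : signature) : option (sort sg) -> Type :=
| FVar (v : fvar sg) : fterm v.1
| FApp (f : func sg) (t : forall i : 'I_(farity f), fterm (Some (fdom i))) :
    fterm (Some (fcod f))
| FCount (s : sort sg) (x : nat) (phi : fform sg) : @fterm sg None
with fform (sg : signature) : Type :=
| FEq (s : option (sort sg)) (t1 t2 : fterm s)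
| FRel (r : rsym sg) (t : forall i : 'I_(rarity r), fterm (Some (rdom i)))
| FSucc (t1 t2 : @fterm sg None)
| FRVar (X : frvar sg) (t : forall i : 'I_(size X.2), fterm (nth_sort i))
| FNot (phi : fform sg)
| FAnd (phi psi : fform sg)
| FEx (v : fvar sg) (phi : fform sg)
| FIfp (X : nat) (a : seq (option (sort sg))) (xs : (size a).-tuple nat)
    (xs_uniq : uniq xs) (phi : fform sg)
    (t : forall i : 'I_(size a), fterm (nth_sort i)).

Definition xtuple (sg : signature) (M : structure sg)
    (a : seq (option (sort sg))) : finType :=
  {dffun forall i : 'I_(size a), xdom M (nth_sort i)}.

Definition fassign (sg : signature) (M : structure sg) : Type :=
  forall v : fvar sg, xdom M v.1.

Definition frassign (sg : signature) (M : structure sg) : Type :=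
  forall X : frvar sg, {set xtuple M X.2}.

Definition assign_tuple (sg : signature) (M : structure sg) (e : fassign M)
    (a : seq (option (sort sg))) (xs : (size a).-tuple nat)
    (b : xtuple M a) : fassign M :=
  foldr (fun (i : 'I_(size a)) (e' : fassign M) =>
           @dfwith (fvar sg) (fun v => xdom M v.1) e'
             (nth_sort i, tnth xs i) (b i))
        e (enum 'I_(size a)).

(* The stages X_0 = set0, X_(n+1) = X_n :|: F X_n increase, hence they are
   constant from n = #|T| on. *)
Definition ifp (T : finType) (F : {set T} -> {set T}) : {set T} :=
  iter #|T| (fun X => X :|: F X) set0.

(* The [inord] never truncates: the cardinal it is applied to is at most
   [size_of M]. *)
Fixpoint fteval (sg : signature) (M : structure sg) (e : fassign M)
    (rho : frassign M) (s : option (sort sg)) (t : fterm s) {struct t} :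
    xdom M s :=
  match t in fterm s0 return xdom M s0 with
  | FVar v => e v
  | FApp f t =>
      @fun_int sg M f (fun i => @fteval sg M e rho (Some (fdom i)) (t i))
  | FCount s x phi =>
      inord #|[set a : dom M s |
        fsat (@dfwith (fvar sg) (fun v => xdom M v.1) e (Some s, x) a) rho phi]|
        : 'I_(size_of M).+1
  end
with fsat (sg : signature) (M : structure sg) (e : fassign M)
    (rho : frassign M) (phi : fform sg) {struct phi} : bool :=
  match phi with
  | FEq s t1 t2 => fteval e rho t1 == fteval e rho t2
  | FRel r t =>
      @rel_int sg M r (fun i => @fteval sg M e rho (Some (rdom i)) (t i))
  | FSucc t1 t2 =>
      let n1 : 'I_(size_of M).+1 := fteval e rho t1 in
      let n2 : 'I_(size_of M).+1 := fteval e rho t2 in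
      n2 == n1.+1 :> nat
  | FRVar X t => ([ffun i => fteval e rho (t i)] : xtuple M X.2) \in rho X
  | FNot phi => ~~ fsat e rho phi
  | FAnd phi psi => fsat e rho phi && fsat e rho psi
  | FEx v phi => [exists a : xdom M v.1, fsat (dfwith e a) rho phi]
  | FIfp X a xs _ phi t =>
      ([ffun i => fteval e rho (t i)] : xtuple M a) \in
        ifp (fun R : {set xtuple M a} =>
          [set b | fsat (assign_tuple e xs b)
             (@dfwith (frvar sg) (fun Y => {set xtuple M Y.2}) rho (X, a) R)
             phi])
  end.

(* [z] is either a first-order variable or a relation variable. *)
Fixpoint ftfree (sg : signature) (z : fvar sg + frvar sg)
    (s : option (sort sg)) (t : fterm s) {struct t} : Prop :=
  match t with
  | FVar w => z = inl w
  | FApp f t => exists i, ftfree z (t i)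
  | FCount s x phi => z <> inl (Some s, x) /\ ffree z phi
  end
with ffree (sg : signature) (z : fvar sg + frvar sg) (phi : fform sg)
    {struct phi} : Prop :=
  match phi with
  | FEq s t1 t2 => ftfree z t1 \/ ftfree z t2
  | FRel r t => exists i, ftfree z (t i)
  | FSucc t1 t2 => ftfree z t1 \/ ftfree z t2
  | FRVar X t => z = inr X \/ exists i, ftfree z (t i)
  | FNot phi => ffree z phi
  | FAnd phi psi => ffree z phi \/ ffree z psi
  | FEx v phi => z <> inl v /\ ffree z phi
  | FIfp X a xs _ phi t =>
      (exists i, ftfree z (t i)) \/
      [/\ z <> inr (X, a), forall i, z <> inl (nth_sort i, tnth xs i)
        & ffree z phi]
  end.

Definition fsentence (sg : signature) (phi : fform sg) : Prop :=
  forall z, ~ ffree z phi.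

Definition fmodels (sg : signature) (M : structure sg) (phi : fform sg) :
    Prop :=
  forall (e : fassign M) (rho : frassign M), fsat e rho phi.

Definition FPCard_definable (sg : signature) (I : Type)
    (str : I -> structure sg) (Q : I -> Prop) : Prop :=
  exists phi : fform sg,
    fsentence phi /\ forall i, fmodels (str i) phi <-> Q i.

(** * Multipedes *)

Definition totally_irreflexive (T : eqType) (R : T -> T -> T -> bool) : Prop :=
  forall x y z, R x y z -> uniq [:: x; y; z].

(* The two transpositions generate all permutations of the arguments. *)
Definition symmetric3 (T : Type) (R : T -> T -> T -> bool) : Prop :=
  forall x y z, R x y z = R y x z /\ R x y z = R x z y.

(* The 3-element sets coded by a totally irreflexive symmetric relation. *)
Definition triples (T : finType) (R : T -> T -> T -> bool) : {set {set T}} :=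
  [set H : {set T} | [exists x, exists y, exists z,
                        R x y z && (H == [set x; y; z])]].

Record multipede2 := Multipede2 {
  segment : finType;
  foot : finType;
  seg_of : foot -> segment;
  hyper : segment -> segment -> segment -> bool;
  positive : foot -> foot -> foot -> bool;
  two_feet : forall s, #|[set f | seg_of f == s]| = 2;
  hyper_irr : totally_irreflexive hyper;
  hyper_sym : symmetric3 hyper;
  positive_irr : totally_irreflexive positive;
  positive_sym : symmetric3 positive;
  positive_hyper : forall P : {set foot},
    P \in triples positive -> seg_of @: P \in triples hyper;
  four_positive : forall H : {set segment}, H \in triples hyper ->
    #|[set P in triples positive | seg_of @: P == H]| = 4;
  positive_even : forall P P' : {set foot},
    P \in triples positive -> P' \in triples positive ->
    seg_of @: P = seg_of @: P' -> ~~ odd #|(P :\: P') :|: (P' :\: P)|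
}.

Record multipede3 := Multipede3 {
  mp2 :> multipede2;
  seg_le : rel (segment mp2);
  seg_le_refl : reflexive seg_le;
  seg_le_anti : antisymmetric seg_le;
  seg_le_trans : transitive seg_le;
  seg_le_total : total seg_le
}.

Record multipede4 := Multipede4 {
  mp3 :> multipede3;
  mset : finType;
  eps : segment mp3 -> mset -> bool;
  eps_ext : forall A : {set segment mp3},
    exists! x : mset, A = [set s | eps s x]
}.

Record shod_multipede4 := ShodMultipede4 {
  mp4 :> multipede4;
  shoe : foot mp4;
  shoe_first : forall s : segment mp4, seg_le (seg_of shoe) s
}.

(** ** Multipedes as structures *)

Inductive mp_sort := Seg | Foot | Sets.
Inductive mp_func := SegOf | Shoe.
Inductive mp_rel := Hyper | Positive | Le | Eps.

Definition mp_sort_code (s : mp_sort) : 'I_3 :=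
  match s with
  | Seg => @Ordinal 3 0 isT
  | Foot => @Ordinal 3 1 isT
  | Sets => @Ordinal 3 2 isT
  end.
Definition mp_sort_decode (i : 'I_3) : mp_sort :=
  match val i with 0 => Seg | 1 => Foot | _ => Sets end.
Lemma mp_sort_codeK : cancel mp_sort_code mp_sort_decode.
Proof. by case. Qed.

HB.instance Definition _ := Finite.copy mp_sort (can_type mp_sort_codeK).

Definition mp_farity (f : mp_func) : nat :=
  match f with SegOf => 1 | Shoe => 0 end.

Definition mp_fcod (f : mp_func) : mp_sort :=
  match f with SegOf => Seg | Shoe => Foot end.

Definition mp_rarity (r : mp_rel) : nat :=
  match r with Hyper | Positive => 3 | Le | Eps => 2 end.

Definition mp_rdom (r : mp_rel) (k : 'I_(mp_rarity r)) : mp_sort :=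
  match r with
  | Hyper | Le => Seg
  | Positive => Foot
  | Eps => if val k == 0 then Seg else Sets
  end.

Definition mp_sig : signature :=
  @Signature mp_sort mp_func mp_farity (fun _ _ => Foot) mp_fcod
    mp_rel mp_rarity mp_rdom.

Definition mp_dom (M : shod_multipede4) (s : mp_sort) : finType :=
  match s with Seg => segment M | Foot => foot M | Sets => mset M end.

Lemma mp_dom_gt0 (M : shod_multipede4) (s : mp_sort) : 0 < #|mp_dom M s|.
Proof.
apply/card_gt0P; case: s => /=.
- by exists (seg_of (shoe M)).
- by exists (shoe M).
- by have [x _] := @eps_ext M set0; exists x.
Qed.

Definition mp_fun_int (M : shod_multipede4) (f : mp_func) :
    (forall k : 'I_(mp_farity f), mp_dom M Foot) -> mp_dom M (mp_fcod f) :=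
  match f with
  | SegOf => fun a => seg_of (a ord0)
  | Shoe => fun _ => shoe M
  end.

Definition mp_rel_int (M : shod_multipede4) (r : mp_rel) :
    (forall k : 'I_(mp_rarity r), mp_dom M (mp_rdom k)) -> bool :=
  match r with
  | Hyper => fun a => hyper (a ord0) (a (@Ordinal 3 1 isT)) (a ord_max)
  | Positive => fun a => positive (a ord0) (a (@Ordinal 3 1 isT)) (a ord_max)
  | Le => fun a => seg_le (a ord0) (a ord_max)
  | Eps => fun a => eps (a ord0) (a ord_max)
  end.

Definition mp_structure (M : shod_multipede4) : structure mp_sig :=
  @Structure mp_sig (mp_dom M) (mp_dom_gt0 M)
    (@mp_fun_int M) (@mp_rel_int M).

Definition mp_isomorphic (M N : shod_multipede4) : Prop :=
  isomorphic (mp_structure M) (mp_structure N).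

Definition mp_pair (MN : shod_multipede4 * shod_multipede4) :
    structure (pair_sig mp_sig) :=
  pair_structure (mp_structure MN.1) (mp_structure MN.2).

(* Main.v *)
From Stdlib Require Import FunctionalExtensionality.
From mathcomp Require Import all_boot.
Require Import Defs.

Set Implicit Arguments.
Unset Strict Implicit.
Unset Printing Implicit Defensive.

(* Both negative results come from one family of pairs M, M' of non-isomorphic
   multipedes such that (M, M) and (M, M') are hard to tell apart. The ordering
   and the sort of sets only see segments, which correspond rigidly; all the
   freedom is in swapping the two feet of a segment, so a correspondence is a
   vector x over F_2 indexed by segments, and it respects the hyperedge v iff
   the sum of x over v is the difference of the parities c(v) and c'(v) of the
   positive triples.

   The hyperedges are the vertices, and the segments the edges, of a cubic
   brick wall drawn on an n x n torus (as in the Cai-Fuerer-Immerman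
   construction). M and M' differ in the parity of one hyperedge. Every segment
   lies in two hyperedges, so summing all the equations shows that M and M' are
   not isomorphic. On the other hand there are vectors x that violate a single
   equation, and the violated one can be moved along any path of the wall. As
   long as fewer than n segments matter, some rows and columns are free of them,
   and the violation can be hidden there: this wins the bijective pebble game.
   The shoe only costs one more pebble.

   For fixpoint logic, the stages of an induction stay related under all
   extensions of a position, so a formula of FP+Card uses only a number of
   pebbles bounded in terms of its syntax. *)

(** * Back-and-forth systems *)

Scheme fterm_mind := Induction for fterm Sort Prop
  with fform_mind := Induction for fform Sort Prop.
Combined Scheme fterm_fform_ind from fterm_mind, fform_mind.

(* A winning strategy for Duplicator in the bijective game with N pebbles:
   [cond] is the type of positions, [rank] the number of pebbles, and [corr p a b] says
   that [a] is named by the pebbles of [p] and has [b] as its counterpart. *)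
Record bf_system (sg : signature) (A B : structure sg) (N : nat) := BFSystem {
  cond : Type;
  ext : cond -> cond -> Prop;
  rank : cond -> nat;
  corr : cond -> forall s : sort sg, dom A s -> dom B s -> Prop;
  ext_refl : forall p, ext p p;
  ext_trans : forall q p r, ext p q -> ext q r -> ext p r;
  corr_ext : forall p q s a b, ext p q -> @corr p s a b -> @corr q s a b;
  corr_inj : forall p s a a' b b',
    @corr p s a b -> @corr p s a' b' -> (a == a') = (b == b');
  corr_fun : forall p (f : func sg) (a : forall k, dom A (fdom k)) b,
    (forall k : 'I_(farity f), corr p (a k) (b k)) ->
    @corr p (fcod f) (fun_int a) (fun_int b);
  corr_rel : forall p (r : rsym sg) (a : forall k, dom A (rdom k)) b,
    (forall k : 'I_(rarity r), corr p (a k) (b k)) ->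
    rel_int a = rel_int b;
  corr_forth : forall p, rank p < N -> forall s,
    exists2 f : dom A s -> dom B s, bijective f &
      forall a, exists q, [/\ ext p q, rank q <= (rank p).+1 & corr q a (f a)];
  corr_reduce : forall p q s a b, ext p q -> @corr q s a b ->
    exists r, [/\ ext p r, ext r q, rank r <= (rank p).+1 & @corr r s a b]
}.

Arguments ext {sg A B N} _ _ _.
Arguments rank {sg A B N} _ _.
Arguments corr {sg A B N} _ _ {s} _ _.

Section Preservation.

Variables (sg : signature) (A B : structure sg) (N : nat).
Variable (S : bf_system A B N).
Implicit Types p q r : cond S.

(** Numbers are compared in [nat], since the bounds [(size_of A).+1] and [(size_of B).+1] give
    different types. *)
Definition xcorr p (s : option (sort sg)) : xdom A s -> xdom B s -> Prop :=
  match s with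
  | Some s => fun a b => corr S p a b
  | None => fun a b => a = b :> nat
  end.

Lemma xcorr_ext p q s (a : xdom A s) b :
  ext S p q -> xcorr p a b -> xcorr q a b.
Proof. by case: s a b => [s|] //= a b; apply: corr_ext. Qed.

Lemma xcorr_inj p s (a a' : xdom A s) b b' :
  xcorr p a b -> xcorr p a' b' -> (a == a') = (b == b').
Proof.
case: s a a' b b' => [s|] //= a a' b b'; first exact: corr_inj.
by move=> ab ab'; rewrite -!val_eqE /= ab ab'.
Qed.

(** This is how pebbles are taken back: from a large extension [q] of [p], keep only what the list
    [l] needs, at one [corr_reduce] per entry. *)
Lemma xcorr_reduce p q (J : eqType) (l : seq J) (s : J -> option (sort sg))
    (a : forall j, xdom A (s j)) b :
  ext S p q -> {in l, forall j, xcorr q (a j) (b j)} ->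
  exists r, [/\ ext S p r, ext S r q, rank S r <= rank S p + size l
             & {in l, forall j, xcorr r (a j) (b j)}].
Proof.
move=> pq; elim: l => [|j l IH] ab.
  by exists p; split=> //; rewrite ?addn0 //; apply: ext_refl.
have [|r [pr rq rkr abr]] := IH.
  by move=> i il; apply: ab; rewrite inE il orbT.
have [r' [rr' r'q rkr' abr']] : exists r', [/\ ext S r r', ext S r' q,
    rank S r' <= (rank S r).+1 & xcorr r' (a j) (b j)].
  have := ab j (mem_head _ _); case: (s j) (a j) (b j) => [sj|] aj bj abj.
    exact: corr_reduce.
  by exists r; split=> //; apply: ext_refl.
exists r'; split=> //; first exact: ext_trans rr'.
  by rewrite addnS; apply: leq_trans rkr' _.
move=> i; rewrite inE => /orP[/eqP -> //|il].
exact: xcorr_ext rr' (abr i il).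
Qed.

Lemma card_dom_eq p s : rank S p < N -> #|dom A s| = #|dom B s|.
Proof. by move=> /corr_forth/(_ s)[f /bij_eq_card]. Qed.

Lemma size_of_eq p : rank S p < N -> size_of A = size_of B.
Proof. by move=> pN; apply: eq_bigr => s _; apply: card_dom_eq pN. Qed.

Lemma xcorr_forth p s : rank S p < N ->
  exists2 f : xdom A s -> xdom B s, bijective f &
    forall a, exists q, [/\ ext S p q, rank S q <= (rank S p).+1
                         & xcorr q a (f a)].
Proof.
move=> pN; case: s => [s|]; first exact: corr_forth.
have e : (size_of A).+1 = (size_of B).+1 by rewrite (size_of_eq pN).
exists (cast_ord e).
  by exists (cast_ord (esym e)); [apply: cast_ordK | apply: cast_ordKV].
by move=> a; exists p; split=> //; apply: ext_refl.
Qed.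

Lemma card_xtuple_eq p a : rank S p < N -> #|xtuple A a| = #|xtuple B a|.
Proof.
move=> pN; rewrite !card_dep_ffun; congr (foldr muln 1 _); apply: eq_map => i.
by have [f /bij_eq_card] := xcorr_forth (nth_sort i) pN.
Qed.

Lemma xcorr_dfwith (V : eqType) (s : V -> option (sort sg)) p
    (e : forall v, xdom A (s v)) e' v a b w :
  xcorr p a b -> (w <> v -> xcorr p (e w) (e' w)) ->
  xcorr p (dfwith e (i := v) a w) (dfwith e' (i := v) b w).
Proof.
move=> ab ee'; case: (eqVneq w v) => [->|ne]; first by rewrite !dfwith_in.
by rewrite !dfwith_out 1?eq_sym //; apply: ee'; apply/eqP.
Qed.

(** * Invariance of infinitary counting logic *)

Section Counting.
Variable k : nat.

Lemma corr_cteval p (e : cassign A k) (e' : cassign B k) 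
    (s : sort sg) (t : cterm k s) :
  (forall v, corr S p (e v) (e' v)) -> corr S p (cteval e t) (cteval e' t).
Proof. by move=> ee'; elim: t => [v|f t IH] //=; apply: corr_fun. Qed.

(** The induction runs over all extensions [p] of a fixed [p0]. A quantifier costs a fresh pebble,
    so before each one the position is cut back to the values of the [#|sort sg| * k] variables; the
    bijection of Duplicator then carries witness sets to witness sets of the same size. *)
Lemma csat_invariant p0 (phi : cform sg k) : rank S p0 + #|sort sg| * k < N ->
  forall p (e : cassign A k) (e' : cassign B k),
    ext S p0 p -> (forall v, corr S p (e v) (e' v)) ->
    csat e phi <-> csat e' phi.
Proof.
move=> p0N; elim: phi => [s t1 t2|r t|phi IH|J phi IH|J phi IH|m v phi IH]
    p e e' p0p ee' /=.
- have eq12 := corr_inj (corr_cteval t1 ee') (corr_cteval t2 ee').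
  by split=> /eqP eqt; apply/eqP; rewrite ?eq12 // -eq12.
- by rewrite (corr_rel (b := fun i => cteval e' (t i)) (p := p)) // => i;
    apply: corr_cteval.
- by have := IH _ _ _ p0p ee'; tauto.
- by split=> H i; apply/(IH i _ _ _ p0p ee').
- by split=> -[i H]; exists i; apply/(IH i _ _ _ p0p ee').
have [|r [p0r _ rkr ee'r]] := @xcorr_reduce p0 p (sort sg * 'I_k)%type 
   (enum {: sort sg * 'I_k}) (fun v => Some v.1) e e' p0p.
  by move=> w _; apply: ee'.
have rN : rank S r < N.
  apply: leq_ltn_trans rkr _; rewrite -cardE card_prod card_ord; exact: p0N.
have [f bf fP] := corr_forth rN v.1.
have [g fK gK] := bf.
have step a : csat (dfwith e a) phi <-> csat (dfwith e' (f a)) phi.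
  have [q [rq _ afa]] := fP a.
  apply: (IH q); first exact: ext_trans rq.
  move=> w.
  apply: (@xcorr_dfwith (cvar sg k) (fun v => Some v.1) q e e' v) => //.
  by move=> _; apply: (corr_ext rq); apply: ee'r; rewrite mem_enum.
split=> -[X mX XP].
  exists (f @: X); first by rewrite card_imset //; apply: bij_inj.
  by move=> _ /imsetP[a aX ->]; apply/step/XP.
exists (g @: X); first by rewrite card_imset //; apply: can_inj gK.
by move=> _ /imsetP[a aX ->]; apply/step; rewrite gK; apply: XP.
Qed.

(** [cmodels B] speaks of every assignment in [B]; each one is pulled back to [A], one variable at a
    time, through the inverse bijections. *)
Lemma corr_assign p (e' : cassign B k) (l : seq (cvar sg k)) :
  rank S p + size l <= N -> exists (e : cassign A k) q,
    [/\ ext S p q, rank S q <= rank S p + size l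
      & {in l, forall v, corr S q (e v) (e' v)}].
Proof.
elim: l => [_|v l IH /=].
  exists (fun v => xchoose (card_gt0P (dom_gt0 A v.1))), p; split=> //.
    exact: ext_refl.
  by rewrite addn0.
rewrite addnS => pN; have [|e [q [pq rq ee']]] := IH; first exact: ltnW.
have [f [g _ gK] fP] := corr_forth (leq_ltn_trans rq pN) v.1.
have [r [qr rr afa]] := fP (g (e' v)); rewrite gK in afa.
exists (dfwith e (g (e' v))), r; split; first exact: ext_trans qr.
  exact: leq_trans rr _.
move=> w; rewrite inE; case: (eqVneq w v) => [-> _|ne /= wl].
  by rewrite dfwith_in.
by rewrite dfwith_out 1?eq_sym //; apply: corr_ext qr _; apply: ee'.
Qed.

Lemma cmodels_invariant p0 (phi : cform sg k) :
  rank S p0 + #|sort sg| * k < N -> cmodels A phi -> cmodels B phi.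
Proof.
move=> p0N Aphi e'.
have [|e [q [p0q _ ee']]] :=
  @corr_assign p0 e' (enum {: sort sg * 'I_k}).
  by rewrite -cardE card_prod card_ord; apply: ltnW.
have {}ee' v : corr S q (e v) (e' v) by apply: ee'; rewrite mem_enum.
exact: (proj1 (csat_invariant phi p0N p0q ee') (Aphi e)).
Qed.

End Counting.

(** * Invariance of fixpoint logic with counting *)

(** The pebbles that an evaluation may add: one per nested quantifier or counting term and one per
    argument of a fixpoint relation, independently of the number of stages. *)
Fixpoint ftdepth (s : option (sort sg)) (t : fterm s) : nat :=
  match t with
  | FVar _ => 0
  | FApp f t => \max_i ftdepth (t i)
  | FCount s x phi => (fdepth phi).+1
  end
with fdepth (phi : fform sg) : nat :=
  match phi with
  | FEq s t1 t2 => maxn (ftdepth t1) (ftdepth t2)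
  | FRel r t => \max_i ftdepth (t i)
  | FSucc t1 t2 => maxn (ftdepth t1) (ftdepth t2)
  | FRVar X t => \max_i ftdepth (t i)
  | FNot phi => fdepth phi
  | FAnd phi psi => maxn (fdepth phi) (fdepth psi)
  | FEx v phi => (fdepth phi).+1
  | FIfp X a xs _ phi t => maxn (size a + fdepth phi) (\max_i ftdepth (t i))
  end.

Definition tuple_corr p (a : seq (option (sort sg)))
    (u : xtuple A a) (v : xtuple B a) : Prop :=
  forall i, xcorr p (u i) (v i).

(* The quantification over all extensions, whatever their rank, keeps relation
   variables related while element variables are pebbled anew. *)
Definition rel_corr p (a : seq (option (sort sg)))
    (R : {set xtuple A a}) (R' : {set xtuple B a}) : Prop :=
  forall q u v, ext S p q -> tuple_corr q u v -> (u \in R) = (v \in R').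

Lemma rel_corr_ext p q a (R : {set xtuple A a}) R' :
  ext S p q -> rel_corr p R R' -> rel_corr q R R'.
Proof. by move=> pq RR' r u v qr; apply: RR'; apply: ext_trans qr. Qed.

Lemma rel_corr_dfwith p (rho : frassign A) (rho' : frassign B) (X : frvar sg)
    (R : {set xtuple A X.2}) R' Y :
  rel_corr p R R' -> (Y <> X -> rel_corr p (rho Y) (rho' Y)) ->
  rel_corr p (@dfwith (frvar sg) (fun Y => {set xtuple A Y.2}) rho X R Y)
    (@dfwith (frvar sg) (fun Y => {set xtuple B Y.2}) rho' X R' Y).
Proof.
move=> RR' rr'; case: (eqVneq Y X) => [->|ne]; first by rewrite !dfwith_in.
by rewrite !dfwith_out 1?eq_sym //; apply: rr'; apply/eqP.
Qed.

Lemma xcorr_assign_tuple p (e : fassign A) (e' : fassign B)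
    (a : seq (option (sort sg))) (xs : (size a).-tuple nat)
    (u : xtuple A a) (v : xtuple B a) w :
  tuple_corr p u v ->
  ((forall i : 'I_(size a), w <> (nth_sort i, tnth xs i)) ->
   xcorr p (e w) (e' w)) ->
  xcorr p (assign_tuple e xs u w) (assign_tuple e' xs v w).
Proof.
move=> uv ee'; rewrite /assign_tuple.
have {}ee' : (forall i, i \in enum 'I_(size a) ->
    w <> (nth_sort i, tnth xs i)) -> xcorr p (e w) (e' w).
  by move=> wn; apply: ee' => i; apply: wn; rewrite mem_enum.
elim: (enum _) ee' => [|i l IH] ee' /=; first exact: ee'.
apply: (@xcorr_dfwith (fvar sg) fst) => [|wi]; first exact: uv.
apply: IH => wl; apply: ee' => j; rewrite inE => /orP[/eqP -> //|].
exact: wl.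
Qed.

(** Only the variables in [F] have to correspond; for the free variables of a sentence, this holds
    between arbitrary assignments. *)
Definition fv_corr p (F : fvar sg + frvar sg -> Prop) (e : fassign A)
    (e' : fassign B) (rho : frassign A) (rho' : frassign B) : Prop :=
  (forall v, F (inl v) -> xcorr p (e v) (e' v)) /\
  (forall X, F (inr X) -> rel_corr p (rho X) (rho' X)).

Lemma fv_corr_sub p (F G : fvar sg + frvar sg -> Prop) e e' rho rho' :
  (forall z, G z -> F z) -> fv_corr p F e e' rho rho' ->
  fv_corr p G e e' rho rho'.
Proof. by move=> GF [ee' rr']; split=> v /GF; [apply: ee'|apply: rr']. Qed.

Lemma fv_corr_ext p q F e e' rho rho' :
  ext S p q -> fv_corr p F e e' rho rho' -> fv_corr q F e e' rho rho'.
Proof.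
move=> pq [ee' rr']; split=> v Fv; first exact: xcorr_ext pq (ee' v Fv).
exact: rel_corr_ext pq (rr' v Fv).
Qed.

Lemma fv_corr_dfwith p (F : fvar sg + frvar sg -> Prop) e e' rho rho'
    (v : fvar sg) (a : xdom A v.1) b :
  xcorr p a b -> fv_corr p (fun z => z <> inl v /\ F z) e e' rho rho' ->
  fv_corr p F (@dfwith (fvar sg) (fun v => xdom A v.1) e v a)
    (@dfwith (fvar sg) (fun v => xdom B v.1) e' v b) rho rho'.
Proof.
move=> ab [ee' rr']; split=> w Fw; last by apply: rr'.
apply: (@xcorr_dfwith (fvar sg) fst) => // wv.
by apply: ee'; split=> // -[].
Qed.

Lemma fteval_fsat_invariant :
  (forall (s : option (sort sg)) (t : fterm s) p e e' rho rho',
     rank S p + ftdepth t < N ->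
     fv_corr p (fun z => ftfree z t) e e' rho rho' ->
     xcorr p (fteval e rho t) (fteval e' rho' t)) /\
  (forall (phi : fform sg) p e e' rho rho', rank S p + fdepth phi < N ->
     fv_corr p (fun z => ffree z phi) e e' rho rho' ->
     fsat e rho phi = fsat e' rho' phi).
Proof.
apply: fterm_fform_ind.
- by move=> v p e e' rho rho' _ [ee' _] /=; apply: ee'.
- move=> f t IH p e e' rho rho' pN ee' /=; apply: corr_fun => i.
  apply: IH; last by apply: fv_corr_sub ee' => z zi; exists i.
  by apply: leq_ltn_trans pN; rewrite leq_add2l (leq_bigmax i).
- move=> s x phi IH p e e' rho rho' /= pN ee'.
  have pN' : rank S p < N by apply: leq_ltn_trans pN; apply: leq_addr.
  (* Equal sizes make [inord] act alike on both sides; the counted sets correspond under the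
     bijection [f]. *)
  rewrite (size_of_eq pN'); congr (nat_of_ord (inord _)).
  have [f bf fP] := corr_forth pN' s.
  rewrite -(card_imset _ (bij_inj bf)); apply: eq_card => b.
  have [g fK gK] := bf.
  have [q [pq rq cq]] := fP (g b); rewrite gK in cq.
  rewrite (can2_imset_pre _ fK gK) !inE; apply: (IH q).
    by apply: leq_ltn_trans pN; rewrite addnS -addSn leq_add2r.
  by apply: fv_corr_dfwith => //; apply: fv_corr_ext pq ee'.
- move=> s t1 IH1 t2 IH2 p e e' rho rho' /= pN ee'; apply: xcorr_inj.
    apply: IH1; last by apply: fv_corr_sub ee' => z; left.
    by apply: leq_ltn_trans pN; rewrite leq_add2l leq_maxl.
  apply: IH2; last by apply: fv_corr_sub ee' => z; right.
  by apply: leq_ltn_trans pN; rewrite leq_add2l leq_maxr.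
- move=> r t IH p e e' rho rho' /= pN ee'; apply: corr_rel => i.
  apply: IH; last by apply: fv_corr_sub ee' => z zi; exists i.
  by apply: leq_ltn_trans pN; rewrite leq_add2l (leq_bigmax i).
- move=> t1 IH1 t2 IH2 p e e' rho rho' /= pN ee'.
  have -> : fteval e rho t1 = fteval e' rho' t1 :> nat.
    apply: (IH1 p); last by apply: fv_corr_sub ee' => z; left.
    by apply: leq_ltn_trans pN; rewrite leq_add2l leq_maxl.
  have -> // : fteval e rho t2 = fteval e' rho' t2 :> nat.
  apply: (IH2 p); last by apply: fv_corr_sub ee' => z; right.
  by apply: leq_ltn_trans pN; rewrite leq_add2l leq_maxr.
- move=> X t IH p e e' rho rho' /= pN ee'.
  apply: (proj2 ee' X _ p); [by left | exact: ext_refl | move=> i].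
  rewrite !ffunE; apply: IH.
    by apply: leq_ltn_trans pN; rewrite leq_add2l (leq_bigmax i).
  by apply: fv_corr_sub ee' => z zi; right; exists i.
- by move=> phi IH p e e' rho rho' /= pN ee'; congr negb; apply: IH pN ee'.
- move=> phi IH1 psi IH2 p e e' rho rho' /= pN ee'; congr andb.
    apply: (IH1 p); last by apply: fv_corr_sub ee' => z; left.
    by apply: leq_ltn_trans pN; rewrite leq_add2l leq_maxl.
  apply: (IH2 p); last by apply: fv_corr_sub ee' => z; right.
  by apply: leq_ltn_trans pN; rewrite leq_add2l leq_maxr.
- move=> v phi IH p e e' rho rho' /= pN ee'.
  have pN' : rank S p < N by apply: leq_ltn_trans pN; apply: leq_addr.
  have [f [g fK gK] fP] := xcorr_forth v.1 pN'.
  have step a : fsat (dfwith e a) rho phi = fsat (dfwith e' (f a)) rho' phi.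
    have [q [pq rq cq]] := fP a; apply: (IH q).
      by apply: leq_ltn_trans pN; rewrite addnS -addSn leq_add2r.
    by apply: fv_corr_dfwith => //; apply: fv_corr_ext pq ee'.
  apply/existsP/existsP => -[a sat_a]; first by exists (f a); rewrite -step.
  by exists (g a); rewrite step gK.
move=> X a xs xs_uniq phi IH t IHt p e e' rho rho' /= pN ee'.
have pN' : rank S p < N by apply: leq_ltn_trans pN; apply: leq_addr.
set FA := fun R => [set b | _]; set FB := fun R => [set b | _].
(* The stages are related one by one, and by [card_xtuple_eq] both inductions are iterated the same
   number of times. *)
suff RR n : rel_corr p (iter n (fun R => R :|: FA R) set0)
                       (iter n (fun R => R :|: FB R) set0).
  rewrite /ifp (card_xtuple_eq a pN'); apply: (RR _ p); first exact: ext_refl.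
  move=> i; rewrite !ffunE; apply: IHt.
    apply: leq_ltn_trans pN; rewrite leq_add2l.
    by apply: leq_trans (leq_maxr _ _); rewrite (leq_bigmax i).
  by apply: fv_corr_sub ee' => z zi; left; exists i.
elim: n => [|n IHn] q u v pq uv; first by rewrite !inE.
rewrite /= !inE (IHn q u v pq uv); congr orb.
(* [q] may have any rank, so it is cut down to an extension [r] of [p] naming just the tuple; this
   costs [size a] pebbles and leaves enough for [phi]. *)
have [|r [pr _ rkr uvr]] := @xcorr_reduce p q _ (enum 'I_(size a))
  (fun i => nth_sort i) u v pq; first by move=> i _; apply: uv.
have {}uvr : tuple_corr r u v by move=> i; apply: uvr; rewrite mem_enum.
apply: (IH r).
  apply: leq_ltn_trans pN; rewrite size_enum_ord in rkr.
  apply: leq_trans (leq_add rkr (leqnn _)) _.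
  by rewrite -addnA leq_add2l leq_maxl.
have [ee1 rr1] := fv_corr_ext pr ee'; split=> [w Fw|Y FY].
  by apply: xcorr_assign_tuple => // wn; apply: ee1; right; split=> // i [] /wn.
apply: (@rel_corr_dfwith _ _ _ (X, a)); first exact: rel_corr_ext pr IHn.
by move=> YX; apply: rr1; right; split=> // -[].
Qed.

Lemma fmodels_invariant p (phi : fform sg) :
  rank S p + fdepth phi < N -> fsentence phi -> fmodels A phi -> fmodels B phi.
Proof.
move=> pN closed Aphi e' rho'.
pose e : fassign A := fun v => match v.1 as s return xdom A s with
  | Some s => xchoose (card_gt0P (dom_gt0 A s)) | None => ord0 end.
rewrite -(proj2 fteval_fsat_invariant phi p e _ (fun _ => set0)) //.
by split=> z /closed.
Qed.

End Preservation.

(** * Pairs of structures *)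

Section PairSystem.

Variables (sg : signature) (M A B : structure sg) (N : nat).
Variable S : bf_system A B N.

(** The common component [M] is matched by the identity, at no cost in pebbles. *)
Definition pair_corr (p : cond S) (s : sort (pair_sig sg)) :
    dom (pair_structure M A) s -> dom (pair_structure M B) s -> Prop :=
  match s with
  | (false, _) => eq
  | (true, _) => corr S p
  end.

Lemma pair_corr_ext p q s a b :
  ext S p q -> @pair_corr p s a b -> pair_corr q a b.
Proof. by case: s a b => -[] s a b //= pq; apply: corr_ext. Qed.

Lemma pair_corr_inj p s a a' b b' :
  @pair_corr p s a b -> @pair_corr p s a' b' -> (a == a') = (b == b').
Proof.
by case: s a a' b b' => -[] s a a' b b' /=; [apply: corr_inj | move=> -> ->].
Qed.

Lemma pair_corr_fun p (f : func (pair_sig sg))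
    (a : forall k, dom (pair_structure M A) (fdom k)) b :
  (forall k : 'I_(farity f), pair_corr p (a k) (b k)) ->
  pair_corr p (fun_int a) (fun_int b).
Proof.
case: f a b => -[] f a b /= ab; first exact: corr_fun.
by congr fun_int; apply: functional_extensionality_dep.
Qed.

Lemma pair_corr_rel p (r : rsym (pair_sig sg))
    (a : forall k, dom (pair_structure M A) (rdom k)) b :
  (forall k : 'I_(rarity r), pair_corr p (a k) (b k)) ->
  rel_int a = rel_int b.
Proof.
case: r a b => -[] r a b /= ab; first exact: corr_rel ab.
by congr rel_int; apply: functional_extensionality_dep.
Qed.

Lemma pair_corr_forth p : rank S p < N -> forall s,
  exists2 f : dom (pair_structure M A) s -> dom (pair_structure M B) s,
    bijective f & forall a, exists q,
      [/\ ext S p q, rank S q <= (rank S p).+1 & pair_corr q a (f a)].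
Proof.
move=> pN [[] s]; first exact: (corr_forth pN s).
exists id; first by exists id.
by move=> a; exists p; split=> //; apply: ext_refl.
Qed.

Lemma pair_corr_reduce p q s a b : ext S p q -> @pair_corr q s a b ->
  exists r,
    [/\ ext S p r, ext S r q, rank S r <= (rank S p).+1 & @pair_corr r s a b].
Proof.
case: s a b => -[] s a b pq; first exact: corr_reduce.
by move=> /= ->; exists p; split=> //; apply: ext_refl.
Qed.

Definition bf_pair :
    bf_system (pair_structure M A) (pair_structure M B) N :=
  BFSystem (@ext_refl _ _ _ _ S) (@ext_trans _ _ _ _ S) pair_corr_ext
    pair_corr_inj pair_corr_fun pair_corr_rel pair_corr_forth pair_corr_reduce.

End PairSystem.

(** * Multipedes of a 3-uniform hypergraph with parities *)

Section Set3.
Variable T : finType.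
Implicit Types x y z : T.

Lemma uniq_set3 x y z : #|[set x; y; z]| = 3 -> uniq [:: x; y; z].
Proof.
move=> card3; apply/card_uniqP; rewrite /= -card3; apply: eq_card => t.
by rewrite !inE -orbA.
Qed.

Lemma cards3P (X : {set T}) : #|X| = 3 -> exists x y z, X = [set x; y; z].
Proof.
rewrite cardE => X3; have : X = [set t in enum X].
  by apply/setP=> t; rewrite inE mem_enum.
case: (enum X) X3 => [|x [|y [|z []]]] // _ ->; exists x, y, z.
by apply/setP=> t; rewrite !inE -orbA.
Qed.

Lemma big_set3 x y z (F : T -> bool) : uniq [:: x; y; z] ->
  \big[addb/false]_(t in [set x; y; z]) F t = F x (+) F y (+) F z.
Proof.
move=> u; rewrite (eq_bigl (fun t => t \in [:: x; y; z])).
  by rewrite -big_uniq //= !big_cons big_nil /= addbF addbA.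
by move=> t; rewrite !inE -orbA.
Qed.

Lemma set3_swap12 x y z : [set x; y; z] = [set y; x; z].
Proof. by rewrite [[set x; y]]setUC. Qed.

Lemma set3_swap23 x y z : [set x; y; z] = [set x; z; y].
Proof. by rewrite setUAC. Qed.

Lemma imset_set3 (U : finType) (f : T -> U) x y z :
  f @: [set x; y; z] = [set f x; f y; f z].
Proof. by rewrite !imsetU !imset_set1. Qed.

End Set3.

(* The initial segments below [x] and [f x] are equinumerous. *)
Lemma order_automorphism_id (T : finType) (le : rel T) (f : T -> T) :
  reflexive le -> antisymmetric le -> transitive le -> total le ->
  bijective f -> (forall x y, le (f x) (f y) = le x y) -> f =1 id.
Proof.
move=> le_refl le_anti le_trans le_total [g fK gK] fle x.
have eqc : #|[set t | le t x]| = #|[set t | le t (f x)]|.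
  rewrite -(card_imset _ (can_inj fK)) (can2_imset_pre _ fK gK).
  by apply: eq_card => t; rewrite !inE -fle gK.
have down y z : le y z -> [set t | le t y] \subset [set t | le t z].
  by move=> yz; apply/subsetP=> t; rewrite !inE => /le_trans; apply.
have /setP eqx : [set t | le t x] = [set t | le t (f x)].
  case/orP: (le_total x (f x)) => /down sub_xf.
    by apply/eqP; rewrite eqEcard sub_xf eqc leqnn.
  by apply/esym/eqP; rewrite eqEcard sub_xf eqc leqnn.
apply: le_anti; have := eqx x; have := eqx (f x).
by rewrite !inE !le_refl => -> <-.
Qed.

Section Multipede.

Variables (E V : finType) (inc : V -> {set E}).
Hypotheses (inc3 : forall v, #|inc v| = 3) (inc_inj : injective inc).
Variable s0 : E.

(** In a graph with the hyperedges as vertices and the segments as edges, this is the boundary of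
    the 1-chain [x] over F_2. *)
Definition boundary (x : E -> bool) (v : V) : bool :=
  \big[addb/false]_(s in inc v) x s.

Lemma boundary_add x y v :
  boundary (fun s => x s (+) y s) v = boundary x v (+) boundary y v.
Proof. exact: big_split. Qed.

Section Charge.
Variable c : V -> bool.

Definition inc_hyper (x y z : E) : bool :=
  [exists v, inc v == [set x; y; z]].

(** The feet of [s] are [(s, false)] and [(s, true)]; [c v] is the common parity of the positive
    triples over [v]. *)
Definition inc_positive (f g h : E * bool) : bool :=
  [exists v, (inc v == [set f.1; g.1; h.1]) && (f.2 (+) g.2 (+) h.2 == c v)].

Lemma inc_hyper_irr : totally_irreflexive inc_hyper.
Proof. by move=> x y z /existsP[v /eqP ev]; apply: uniq_set3; rewrite -ev. Qed.

Lemma inc_hyper_sym : symmetric3 inc_hyper.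
Proof.
move=> x y z; rewrite /inc_hyper.
by rewrite [in RHS]set3_swap12 [in X in _ /\ X]set3_swap23.
Qed.

Lemma inc_positive_segs f g h :
  inc_positive f g h -> uniq [:: f.1; g.1; h.1].
Proof.
by case/existsP=> v /andP[/eqP ev _]; apply: uniq_set3; rewrite -ev.
Qed.

Lemma inc_positive_irr : totally_irreflexive inc_positive.
Proof. by move=> f g h /inc_positive_segs/(@map_uniq _ _ fst [:: f; g; h]). Qed.

Lemma inc_positive_sym : symmetric3 inc_positive.
Proof.
move=> f g h; rewrite /inc_positive; split; apply: eq_existsb => v.
  by rewrite set3_swap12 [f.2 (+) _]addbC.
by rewrite set3_swap23 addbAC.
Qed.

Lemma inc_hyper_triples H :
  (H \in triples inc_hyper) = [exists v, H == inc v].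
Proof.
rewrite inE; apply/existsP/existsP => [[x /existsP[y /existsP[z]]]|[v /eqP ->]].
  by case/andP=> /existsP[v /eqP <-] eH; exists v.
have [x [y [z e]]] := cards3P (inc3 v); exists x.
apply/existsP; exists y; apply/existsP; exists z; rewrite e eqxx andbT.
by apply/existsP; exists v; rewrite e.
Qed.

Definition section (x : E -> bool) (v : V) : {set E * bool} :=
  [set (s, x s) | s in inc v].

Lemma inc_positive_triples P :
  P \in triples inc_positive <->
  exists v x, P = section x v /\ boundary x v = c v.
Proof.
rewrite inE; split=> [/existsP[f /existsP[g /existsP[h]]]|[v [x [-> dx]]]].
  case/andP=> pos /eqP ->; have u := inc_positive_segs pos.
  case/existsP: pos => v /andP[/eqP ev /eqP cv].
  (* [x] is read off the three feet; [h.2] doubles as its default value off the hyperedge. *)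
  exists v, (fun s => if s == f.1 then f.2 else if s == g.1 then g.2 else h.2).
  rewrite /section /boundary ev imset_set3 big_set3 // -cv eqxx.
  move: u; rewrite /= !inE negb_or => /andP[/andP[fg fh] /andP[gh _]].
  rewrite eq_sym (negPf fg) eqxx eq_sym (negPf fh) eq_sym (negPf gh).
  by case: f g h {ev cv fg fh gh} => ? ? [? ?] [? ?].
have [s [t [r e]]] := cards3P (inc3 v).
have u : uniq [:: s; t; r] by apply: uniq_set3; rewrite -e.
rewrite /section e imset_set3.
apply/existsP; exists (s, x s); apply/existsP; exists (t, x t).
apply/existsP; exists (r, x r); rewrite eqxx andbT.
by apply/existsP; exists v; rewrite e eqxx -dx /boundary e big_set3 /=.
Qed.

Lemma fst_section x v : fst @: section x v = inc v.
Proof. by rewrite /section -imset_comp /comp imset_id. Qed.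

Lemma card_section x v : #|section x v| = 3.
Proof. by rewrite card_imset // => s t []. Qed.

Lemma inc_positive_hyper P :
  P \in triples inc_positive -> fst @: P \in triples inc_hyper.
Proof.
case/inc_positive_triples=> v [x [-> _]].
by rewrite fst_section inc_hyper_triples; apply/existsP; exists v.
Qed.

Lemma inc_four_positive H : H \in triples inc_hyper ->
  #|[set P in triples inc_positive | fst @: P == H]| = 4.
Proof.
rewrite inc_hyper_triples => /existsP[v /eqP ->].
have [s [t [r e]]] := cards3P (inc3 v).
have u : uniq [:: s; t; r] by apply: uniq_set3; rewrite -e.
(* Two labels are free, and the parity [c v] forces the third. *)
pose F (b : bool * bool) := [set (s, b.1); (t, b.2); (r, b.1 (+) b.2 (+) c v)].
have -> : [set P in triples inc_positive | fst @: P == inc v] =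
          [set F b | b in [set: bool * bool]].
  apply/setP=> P; rewrite !inE; apply/andP/imsetP=> [[posP /eqP eP]|[b _ ->]].
    have /inc_positive_triples[w [x [defP dx]]] : P \in triples inc_positive.
      by rewrite inE.
    have wv : w = v by apply: inc_inj; rewrite -eP defP fst_section.
    move: dx; rewrite defP wv /boundary /section e big_set3 // => dx.
    exists (x s, x t) => //.
    rewrite imset_set3 /F /= -dx; congr (_ :|: [set (r, _)]).
    by case: (x s) (x t) (x r) => -[] [].
  split; last by rewrite /F imset_set3 /= e.
  apply/existsP; exists (s, b.1); apply/existsP; exists (t, b.2).
  apply/existsP; exists (r, b.1 (+) b.2 (+) c v); rewrite eqxx andbT.
  apply/existsP; exists v; rewrite e eqxx /=.
  by case: (c v) b => -[[] []].
rewrite card_imset ?cardsT ?card_prod ?card_bool //.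
move=> [b1 b2] [d1 d2] /setP eF; move: (eF (s, b1)) (eF (t, b2)).
move: u; rewrite /= !inE negb_or => /andP[/andP[st sr] /andP[tr _]].
rewrite !xpair_eqE !eqxx /= (negPf st) (negPf sr) (negPf tr).
by rewrite [t == s]eq_sym (negPf st) /= !orbF => /esym/eqP -> /esym/eqP ->.
Qed.

Lemma two_feet_pair (s : E) : #|[set f : E * bool | f.1 == s]| = 2.
Proof.
suff -> : [set f : E * bool | f.1 == s] = [set (s, true); (s, false)].
  by rewrite cards2 xpair_eqE andbF.
apply/setP=> -[t b]; rewrite !inE !xpair_eqE.
by case: b; rewrite ?andbT ?andbF ?orbF.
Qed.

(** The two differences are disjoint and each has [3 - #|P :&: P'|] elements. *)
Lemma inc_positive_even P P' :
  P \in triples inc_positive -> P' \in triples inc_positive ->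
  fst @: P = fst @: P' -> ~~ odd #|(P :\: P') :|: (P' :\: P)|.
Proof.
case/inc_positive_triples=> v [x [-> _]] /inc_positive_triples[w [y [-> _]]] _.
rewrite cardsU; set X := section x v; set Y := section y w.
have -> : (X :\: Y) :&: (Y :\: X) = set0.
  by apply/setP=> t; rewrite !inE; case: (t \in X); rewrite ?andbF.
rewrite cards0 subn0 !cardsD setIC !card_section addnn.
by rewrite odd_double.
Qed.

Definition inc_multipede2 : multipede2 :=
  Multipede2 two_feet_pair inc_hyper_irr inc_hyper_sym inc_positive_irr
    inc_positive_sym inc_positive_hyper inc_four_positive inc_positive_even.

Definition rank_le (s t : E) : bool := enum_rank s <= enum_rank t.

Lemma rank_le_refl : reflexive rank_le.
Proof. by move=> s; apply: leqnn. Qed.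

Lemma rank_le_anti : antisymmetric rank_le.
Proof. by move=> s t /anti_leq/val_inj/enum_rank_inj. Qed.

Lemma rank_le_trans : transitive rank_le.
Proof. by move=> t s r; apply: leq_trans. Qed.

Lemma rank_le_total : total rank_le.
Proof. by move=> s t; apply: leq_total. Qed.

Definition inc_multipede3 : multipede3 :=
  @Multipede3 inc_multipede2 rank_le rank_le_refl rank_le_anti rank_le_trans
    rank_le_total.

Lemma mem_ext (A : {set E}) : exists! X : {set E}, A = [set s | s \in X].
Proof.
by exists A; split=> [|X ->]; apply/setP=> s; rewrite inE.
Qed.

Definition inc_multipede4 : multipede4 :=
  @Multipede4 inc_multipede3 {set E} (fun s X => s \in X) mem_ext.

Definition first_seg : E := [arg min_(s < s0) enum_rank s].

Lemma first_seg_le s : rank_le first_seg s.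
Proof. by rewrite /first_seg; case: arg_minnP => // t _; apply. Qed.

Definition inc_multipede : shod_multipede4 :=
  @ShodMultipede4 inc_multipede4 (first_seg, false) first_seg_le.

End Charge.

(** The ordering forces an isomorphism to fix every segment, so on feet it is a vector of swaps,
    [x s] being the label of the image of [(s, false)]. Preserving positive triples gives one
    equation per hyperedge. *)
Lemma inc_isomorphic_boundary c c' :
  mp_isomorphic (inc_multipede c) (inc_multipede c') ->
  exists x, forall v, boundary x v = c v (+) c' v.
Proof.
case=> h [bij_h fun_h rel_h].
pose hs : E -> E := h Seg; pose hf : E * bool -> E * bool := h Foot.
have hs_id : hs =1 id.
  apply: (@order_automorphism_id _ rank_le); [exact: rank_le_refl |
    exact: rank_le_anti | exact: rank_le_trans | exact: rank_le_total |
    exact: (bij_h Seg) | move=> s t].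
  exact: (rel_h Le (fun k => if k == ord0 then s else t)).
have hf1 f : (hf f).1 = f.1.
  by rewrite -[RHS]hs_id; apply: esym; apply: (fun_h SegOf (fun _ => f)).
have hf_pos f g k :
    inc_positive c' (hf f) (hf g) (hf k) = inc_positive c f g k.
  exact: (rel_h Positive (fun i : 'I_3 => nth f [:: f; g; k] i)).
have hf_inj : injective hf := bij_inj (bij_h Foot).
exists (fun s => (hf (s, false)).2) => v.
have [s [t [r e]]] := cards3P (inc3 v).
have u : uniq [:: s; t; r] by apply: uniq_set3; rewrite -e.
have neg_foot : (hf (r, true)).2 = ~~ (hf (r, false)).2.
  have : hf (r, true) <> hf (r, false) by move/hf_inj.
  move: (hf1 (r, true)) (hf1 (r, false)).
  case: (hf (r, true)) => r1 b1; case: (hf (r, false)) => r2 b2 /= -> ->.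
  by case: b1 b2 => -[].
(* A test triple of parity [c v]: its image must have parity [c' v], and the swaps account for the
   difference. *)
have : inc_positive c (s, false) (t, false) (r, c v).
  by apply/existsP; exists v; rewrite /= e eqxx /=.
rewrite -hf_pos => /existsP[w]; rewrite !hf1 /= -e.
case/andP=> /eqP/inc_inj -> /eqP <-.
rewrite /boundary e big_set3 //.
case: (c v); rewrite ?neg_foot;
  by case: (hf (s, false)).2 (hf (t, false)).2 (hf (r, false)).2 => -[] [].
Qed.

End Multipede.

(** * Twisting the feet *)

Section Twist.

Variables (E V : finType) (inc : V -> {set E}).
Hypotheses (inc3 : forall v, #|inc v| = 3) (inc_inj : injective inc).
Variables (s0 : E) (c c' : V -> bool).

Local Notation first := (first_seg s0).
Local Notation M := (mp_structure (inc_multipede inc3 inc_inj s0 c)).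
Local Notation M' := (mp_structure (inc_multipede inc3 inc_inj s0 c')).

(** Adding [y] to a vector moves a violated equation from [v] to [w] without changing the swaps on
    [P]. *)
Definition linked (P : {set E}) (v w : V) : Prop :=
  exists2 y : E -> bool, {in P, forall s, y s = false} &
    forall u, boundary inc y u = (u == v) (+) (u == w).

Lemma linked_refl P v : linked P v v.
Proof.
exists (fun _ => false) => // u; rewrite addbb /boundary.
by rewrite big1_eq.
Qed.

Lemma linked_sym P v w : linked P v w -> linked P w v.
Proof. by case=> y yP dy; exists y => // u; rewrite dy addbC. Qed.

Lemma linked_trans P w v u : linked P v w -> linked P w u -> linked P v u.
Proof.
case=> y yP dy [z zP dz]; exists (fun s => y s (+) z s).
  by move=> s sP; rewrite yP ?zP.
move=> t; rewrite boundary_add dy dz.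
by case: (t == v) (t == w) (t == u) => -[] [].
Qed.

Lemma linked_edge (P : {set E}) s v w : s \notin P ->
  (forall u, (s \in inc u) = (u == v) (+) (u == w)) -> linked P v w.
Proof.
move=> sP su; exists (pred1 s) => [t tP|u].
  by apply/negbTE; apply: contraNneq sP => <-.
rewrite -su /boundary; case: (boolP (s \in inc u)) => [sinc|ninc].
  rewrite (bigD1 s) //= eqxx big1 // => t /andP[_ /negbTE //].
by rewrite big1 // => t tinc; apply: contraNF ninc => /eqP <-.
Qed.

(* [haven P v]: when the feet of the segments in [P] are pebbled, the
   inconsistency between the two charges may be hidden at the hyperedge [v]. *)
Variables (N : nat) (haven : {set E} -> V -> Prop).
(** Openness keeps the violation off the fully pebbled hyperedges; existence and linking let
    Duplicator carry it out of the way of a new pebble. *)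
Hypothesis haven_open : forall P v, haven P v -> ~~ (inc v \subset P).
Hypothesis haven_sub :
  forall (P Q : {set E}) v, P \subset Q -> haven Q v -> haven P v.
Hypothesis haven_ex : forall P : {set E}, #|P| <= N -> exists v, haven P v.
Hypothesis haven_linked : forall (P : {set E}) v w,
  #|P| <= N -> haven P v -> haven P w -> linked P v w.

(** The shoes are constants, so their segment is always pebbled and never swapped. All equations
    hold except the one at a haven. *)
Definition good_twist (p : {set E} * (E -> bool)) : Prop :=
  [/\ first \in p.1, p.2 first = false & exists2 v, haven p.1 v &
      forall u, boundary inc p.2 u = c u (+) c' u (+) (u == v)].

Definition twist : Type := {p | good_twist p}.
Implicit Types p q r : twist.

Definition pebbled p : {set E} := (sval p).1.
Definition twist_fun p : E -> bool := (sval p).2.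

Definition twist_ext p q : Prop :=
  pebbled p \subset pebbled q /\ {in pebbled p, twist_fun q =1 twist_fun p}.

(** A pebbled segment names both of its feet; segments and sets are rigid and need no pebble. *)
Definition twist_corr p (s : mp_sort) : dom M s -> dom M' s -> Prop :=
  match s return dom M s -> dom M' s -> Prop with
  | Foot => fun f g : E * bool =>
      f.1 \in pebbled p /\ g = (f.1, f.2 (+) twist_fun p f.1)
  | Seg | Sets => eq
  end.

Lemma twist_ext_refl p : twist_ext p p.
Proof. by []. Qed.

Lemma twist_ext_trans q p r :
  twist_ext p q -> twist_ext q r -> twist_ext p r.
Proof.
move=> [pq xpq] [qr xqr]; split=> [|s sp]; first exact: subset_trans qr.
by rewrite xqr ?xpq // (subsetP pq).
Qed.

Lemma twist_corr_ext p q s a b :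
  twist_ext p q -> @twist_corr p s a b -> twist_corr q a b.
Proof.
case: s a b => //= f g [pq xpq] [fp ->].
by rewrite (subsetP pq) // xpq.
Qed.

Lemma twist_corr_inj p s a a' b b' :
  @twist_corr p s a b -> @twist_corr p s a' b' -> (a == a') = (b == b').
Proof.
case: s a a' b b' => /= [? ? ? ? -> -> //|f f' g g'|? ? ? ? -> -> //].
case=> _ -> [_ ->]; case: f f' => s x [t y].
rewrite !xpair_eqE /=; case: eqP => //= ->.
by case: (twist_fun p t) x y => -[] [].
Qed.

Lemma twist_corr_fun p (f : func mp_sig) (a : forall k, dom M (fdom k)) b :
  (forall k : 'I_(farity f), twist_corr p (a k) (b k)) ->
  @twist_corr p (fcod f) (fun_int a) (fun_int b).
Proof.
case: f a b => a b /= ab; first by have [_ ->] := ab ord0.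
by case: (svalP p) => fp xp _; split=> //; rewrite /twist_fun xp.
Qed.

(** A hyperedge whose three segments are pebbled is not the haven, by [haven_open], so its equation
    holds and the parities match. *)
Lemma twist_positive p f g h :
  f.1 \in pebbled p -> g.1 \in pebbled p -> h.1 \in pebbled p ->
  inc_positive inc c f g h =
  inc_positive inc c' (f.1, f.2 (+) twist_fun p f.1)
    (g.1, g.2 (+) twist_fun p g.1) (h.1, h.2 (+) twist_fun p h.1).
Proof.
move=> fp gp hp; apply: eq_existsb => u /=; case: eqP => //= eu.
have un : uniq [:: f.1; g.1; h.1] by apply: uniq_set3; rewrite -eu.
case: (svalP p) => _ _ [v /haven_open vp /(_ u)].
have /negPf -> : u != v.
  apply: contraNneq vp => <-; rewrite eu.
  by apply/subsetP=> s; rewrite !inE => /orP[/orP[]|] /eqP ->.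
rewrite /boundary eu big_set3 // -/(twist_fun p).
case: (twist_fun p f.1) (twist_fun p g.1) (twist_fun p h.1) => -[] [];
  by case: (c u) (c' u) => -[] //= _; case: f.2 g.2 h.2 => -[] [].
Qed.

Lemma twist_corr_rel p (r : rsym mp_sig) (a : forall k, dom M (rdom k)) b :
  (forall k : 'I_(rarity r), twist_corr p (a k) (b k)) ->
  rel_int a = rel_int b.
Proof.
case: r a b => a b /= ab; try by rewrite !(ab _).
  have [p0 ->] := ab ord0; have [p1 ->] := ab (@Ordinal 3 1 isT).
  by have [p2 ->] := ab ord_max; apply: twist_positive.
by rewrite (ab ord0) (ab ord_max).
Qed.

Lemma twist_corr_forth p : #|pebbled p| < N -> forall s,
  exists2 f : dom M s -> dom M' s, bijective f &
    forall a, exists q,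
      [/\ twist_ext p q, #|pebbled q| <= #|pebbled p|.+1
       & twist_corr q a (f a)].
Proof.
move=> pN [].
- by exists id => [|a]; [exists id | exists p].
- have step s : exists q, [/\ twist_ext p q, #|pebbled q| <= #|pebbled p|.+1
      & s \in pebbled q].
    have [fp xp [v vp dx]] := svalP p.
    have cQ : #|s |: pebbled p| <= #|pebbled p|.+1.
      by rewrite cardsU1; case: (s \in _).
    have [w wQ] := haven_ex (leq_trans cQ pN).
    (* [y] vanishes on the old pebbles only, so the twist at a new [s] may still change. *)
    have [y y0 dy] := haven_linked (ltnW pN) vp (haven_sub (subsetUr _ _) wQ).
    have gq : good_twist (s |: pebbled p, fun t => twist_fun p t (+) y t).
      split=> /=; first by rewrite inE fp orbT.
        by rewrite y0 // /twist_fun xp.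
      exists w => // u; rewrite boundary_add dy dx.
      by case: (u == v) (u == w) (c u) (c' u) => -[] [] [].
    exists (exist _ _ gq); split=> //; last by rewrite /pebbled /= setU11.
    by split=> [|t tp]; [apply: subsetUr | rewrite /twist_fun /= y0 ?addbF].
  (* [q] depends on the segment and not on the foot, so [f] swaps or fixes the two feet of each
     segment. *)
  have [q qP] := fin_all_exists step.
  pose f (a : E * bool) := (a.1, a.2 (+) twist_fun (q a.1) a.1).
  have fK : involutive f by move=> [s b]; rewrite /f /= -addbA addbb addbF.
  exists f => [|a]; first by exists f.
  by exists (q a.1); have [? ? ?] := qP a.1.
by exists id => [|a]; [exists id | exists p].
Qed.

Lemma twist_corr_reduce p q s a b : twist_ext p q -> @twist_corr q s a b ->
  exists r, [/\ twist_ext p r, twist_ext r q,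
    #|pebbled r| <= #|pebbled p|.+1 & @twist_corr r s a b].
Proof.
case: s a b => /= [s t pq ->||X Y pq ->]; [by exists p | | by exists p].
move=> f g [pq xpq] [fq ->].
have rq : f.1 |: pebbled p \subset pebbled q by rewrite subUset sub1set fq.
(* The twist of [q] is kept and its other pebbles are dropped; a haven for more pebbles is one for
   fewer. *)
have gr : good_twist (f.1 |: pebbled p, twist_fun q).
  have [_ xq [v vq dx]] := svalP q; split=> //=.
    by case: (svalP p) => fp _ _; rewrite inE fp orbT.
  by exists v => //; apply: haven_sub vq.
exists (exist _ _ gr); split=> //.
- by split=> //; apply: subsetUr.
- by rewrite /pebbled /= cardsU1; case: (f.1 \in _).
- by split=> //; rewrite /pebbled /= setU11.
Qed.

Definition bf_twist : bf_system M M' N :=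
  @BFSystem mp_sig M M' N twist twist_ext (fun p => #|pebbled p|) twist_corr
    twist_ext_refl twist_ext_trans twist_corr_ext twist_corr_inj
    twist_corr_fun twist_corr_rel twist_corr_forth twist_corr_reduce.

End Twist.

(** * The brick wall on the torus *)

Section BrickWall.

Variable N : nat.
(** At least two, so that cyclic successors move every index, and more than [N], so that [N]
    segments miss some row and some column. *)
Local Notation n := N.+2.
Local Notation cell := ('I_n * 'I_n)%type.

(* [(None, (i, j))] joins the two hyperedges of the cell [(i, j)];
   [(Some false, (i, j))] and [(Some true, (i, j))] lead from this cell to the
   next one in the row [i] and in the column [j], respectively. *)
Definition wall_seg : finType := (option bool * cell)%type.
Definition wall_hyp : finType := (bool * cell)%type.

(** Row and column segments are indexed by the cell they leave; [(true, a)] is the exit of the cell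
    [a] and [(false, a)] its entrance, whence the predecessors. *)
Definition wall_port (v : wall_hyp) (k : option bool) : wall_seg :=
  let: (b, (i, j)) := v in
  match k with
  | None => (None, (i, j))
  | Some false => (Some false, (i, if b then j else ord_pred j))
  | Some true => (Some true, (if b then i else ord_pred i, j))
  end.

Definition wall_inc (v : wall_hyp) : {set wall_seg} :=
  [set wall_port v k | k : option bool].

Lemma wall_port_fst v k : (wall_port v k).1 = k.
Proof. by case: v => b [i j]; case: k => [[]|]. Qed.

Lemma wall_portI v : injective (wall_port v).
Proof. by move=> k k' /(congr1 fst); rewrite !wall_port_fst. Qed.

Lemma mem_wall_inc k a v : ((k, a) \in wall_inc v) = (wall_port v k == (k, a)).
Proof.
apply/imsetP/eqP=> [[k' _ e]|<-]; last by exists k.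
by have := congr1 fst e; rewrite wall_port_fst /= e => ->.
Qed.

Lemma card_wall_inc v : #|wall_inc v| = 3.
Proof.
rewrite card_imset ?card_option ?card_bool //; exact: wall_portI.
Qed.

Lemma ord_pred_neq (i : 'I_n) : ord_pred i != i.
Proof.
rewrite -{2}[i]ord_predK eq_sym; move: (ord_pred i) => j.
rewrite -val_eqE /=; have := ltn_ord j.
rewrite ltnS leq_eqVlt => /orP[/eqP ->|lt_j]; first by rewrite modnn.
by rewrite modn_small // neq_ltn ltnSn orbT.
Qed.

(** The tag of a segment tells which port it occupies, so the set determines the ports. The port
    [None] gives the cell, and the shift in the row port separates its two hyperedges. *)
Lemma wall_inc_inj : injective wall_inc.
Proof.
move=> v w /setP vw.
have port k : wall_port v k = wall_port w k.
  have := vw (wall_port v k); rewrite [wall_port v k]surjective_pairing.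
  rewrite !mem_wall_inc wall_port_fst -{2}(wall_port_fst v k).
  by rewrite -surjective_pairing eqxx => /esym/eqP.
move: v w port {vw} => [b [i j]] [d [i' j']] port.
have [<- <-] := port None; congr pair.
have [ii' jj'] := port None; have [] := port (Some false).
rewrite -{}ii' -{}jj' => _; case: b d {port} => -[] // /eqP.
  by rewrite eq_sym (negPf (ord_pred_neq j)).
by rewrite (negPf (ord_pred_neq j)).
Qed.

Lemma wall_incE v : wall_inc v =
  [set wall_port v None; wall_port v (Some false); wall_port v (Some true)].
Proof.
apply/setP=> s; rewrite !inE; apply/imsetP/idP=> [[k _ ->]|].
  by case: k => [[]|]; rewrite eqxx ?orbT.
by case/orP=> [/orP[]|] /eqP ->; eexists.
Qed.

Lemma wall_boundaryE x v : boundary wall_inc x v =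
  x (wall_port v None) (+) x (wall_port v (Some false))
    (+) x (wall_port v (Some true)).
Proof.
rewrite /boundary wall_incE big_set3 //.
by apply: uniq_set3; rewrite -wall_incE card_wall_inc.
Qed.

(** Every segment lies in two hyperedges and cancels; for row and column segments the second
    occurrence is found after a cyclic shift of the cells. *)
Lemma wall_boundary_sum x : \big[addb/false]_v boundary wall_inc x v = false.
Proof.
rewrite (eq_bigr (fun v => boundary wall_inc x (v.1, v.2))); last by case.
rewrite -(pair_bigA _ (fun b a => boundary wall_inc x (b, a))) big_bool /=.
rewrite -big_split /=.
pose F k := \big[addb/false]_(a : cell) x (k, a).
have row : F (Some false) =
    \big[addb/false]_(a : cell) x (Some false, (a.1, ord_pred a.2)).
  rewrite /F (reindex (fun a : cell => (a.1, ord_pred a.2))) //.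
  exists (fun a : cell => (a.1, ordS a.2)) => -[i j] _;
    by rewrite /= ?ord_predK ?ordSK.
have col : F (Some true) =
    \big[addb/false]_(a : cell) x (Some true, (ord_pred a.1, a.2)).
  rewrite /F (reindex (fun a : cell => (ord_pred a.1, a.2))) //.
  exists (fun a : cell => (ordS a.1, a.2)) => -[i j] _;
    by rewrite /= ?ord_predK ?ordSK.
rewrite (eq_bigr (fun a : cell => x (Some false, a)
  (+) x (Some false, (a.1, ord_pred a.2))
  (+) (x (Some true, a) (+) x (Some true, (ord_pred a.1, a.2))))).
  by rewrite !big_split /= -row -col !addbb.
move=> [i j] _; rewrite !wall_boundaryE /=.
move: (x (None, (i, j))) (x (Some false, (i, j))) (x (Some true, (i, j)))
  (x (Some false, (i, ord_pred j))) (x (Some true, (ord_pred i, j))).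
by do 5!case.
Qed.

(** The violation must be able to walk along the row of [v], through its cell and row segments;
    column segments there may be pebbled. *)
Definition wall_haven (P : {set wall_seg}) (v : wall_hyp) : Prop :=
  forall j, (None, (v.2.1, j)) \notin P /\ (Some false, (v.2.1, j)) \notin P.

Lemma wall_haven_open (P : {set wall_seg}) v :
  wall_haven P v -> ~~ (wall_inc v \subset P).
Proof.
case: v => b [i j] /(_ j)[/= mP _]; apply: contra mP => /subsetP; apply.
by rewrite mem_wall_inc.
Qed.

Lemma wall_haven_sub (P Q : {set wall_seg}) v :
  P \subset Q -> wall_haven Q v -> wall_haven P v.
Proof.
by move=> /subsetP PQ vQ j; have [mQ hQ] := vQ j; split; apply: contra (PQ _) _.
Qed.

Lemma ord_avoid (P : {set wall_seg}) (f : wall_seg -> 'I_n) :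
  #|P| <= N -> exists i, forall s, s \in P -> f s != i.
Proof.
move=> PN; have : ~~ ([set: 'I_n] \subset f @: P).
  apply: contraL (leq_imset_card f P) => /subset_leq_card.
  rewrite cardsT card_ord -ltnNge; apply: leq_trans.
  by rewrite ltnS ltnW.
case/subsetPn=> i _ ni; exists i => s sP.
by apply: contraNneq ni => <-; apply: imset_f.
Qed.

Lemma wall_haven_ex (P : {set wall_seg}) :
  #|P| <= N -> exists v, wall_haven P v.
Proof.
case/(ord_avoid (fun s => s.2.1))=> i iP; exists (true, (i, ord0)) => j /=.
by split; apply/negP=> /iP; rewrite eqxx.
Qed.

Lemma ord_cyclic_ind (R : 'I_n -> Prop) :
  R ord0 -> (forall i, R i -> R (ordS i)) -> forall i, R i.
Proof.
move=> R0 RS [i lt_i]; elim: i lt_i => [|i IH] lt_i.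
  by rewrite (_ : Ordinal lt_i = ord0) //; apply: val_inj.
have := RS _ (IH (ltnW lt_i)); congr R; apply: val_inj.
by rewrite /= modn_small.
Qed.

Section Linked.
Variable P : {set wall_seg}.
Local Notation linked := (linked wall_inc P).

Lemma linked_cell i j : (None, (i, j)) \notin P ->
  linked (true, (i, j)) (false, (i, j)).
Proof.
move=> mP; apply: (linked_edge mP) => -[b [i' j']].
rewrite mem_wall_inc !xpair_eqE /=.
by case: b; case: eqP; case: eqP.
Qed.

Lemma linked_row i j : (Some false, (i, j)) \notin P ->
  linked (true, (i, j)) (false, (i, ordS j)).
Proof.
move=> mP; apply: (linked_edge mP) => -[b [i' j']].
rewrite mem_wall_inc !xpair_eqE /= -(can2_eq (@ord_predK n) (@ordSK n)).
by case: b => /=; rewrite ?addbF ?addFb.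
Qed.

Lemma linked_col i j : (Some true, (i, j)) \notin P ->
  linked (true, (i, j)) (false, (ordS i, j)).
Proof.
move=> mP; apply: (linked_edge mP) => -[b [i' j']].
rewrite mem_wall_inc !xpair_eqE /= -(can2_eq (@ord_predK n) (@ordSK n)).
by case: b => /=; rewrite ?addbF ?addFb.
Qed.

(** The [f true j] and [f false j] alternate around a closed cycle, to be taken as a row or a column
    of the wall. *)
Lemma linked_cycle (f : bool -> 'I_n -> wall_hyp) :
  (forall j, linked (f true j) (f false j)) ->
  (forall j, linked (f true j) (f false (ordS j))) ->
  forall b j d k, linked (f b j) (f d k).
Proof.
move=> ff ffS.
have f0 j : linked (f true ord0) (f true j).
  elim/ord_cyclic_ind: j => [|j IH]; first exact: linked_refl.
  exact: linked_trans (linked_trans IH (ffS j)) (linked_sym (ff _)).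
have f1 b j : linked (f true ord0) (f b j).
  by case: b => //; apply: linked_trans (ff j).
by move=> b j d k; apply: linked_trans (f1 d k); apply: linked_sym.
Qed.

End Linked.

(** The path runs from [v] along its row to a column [q] without pebbles, then along that column,
    then along the row of [w]. *)
Lemma wall_haven_linked (P : {set wall_seg}) v w : #|P| <= N ->
  wall_haven P v -> wall_haven P w -> linked wall_inc P v w.
Proof.
move=> PN; have [q qP] := ord_avoid (fun s => s.2.2) PN.
have free k i : (k, (i, q)) \notin P by apply/negP=> /qP; rewrite eqxx.
have row b i j d : wall_haven P (b, (i, j)) ->
    linked wall_inc P (b, (i, j)) (d, (i, q)).
  move=> vP; apply: (linked_cycle (f := fun b j => (b, (i, j)))) => l.
    by apply: linked_cell; have [] := vP l.
  by apply: linked_row; have [] := vP l.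
have col b i d k : linked wall_inc P (b, (i, q)) (d, (k, q)).
  apply: (linked_cycle (f := fun b i => (b, (i, q)))) => l.
    exact: linked_cell.
  exact: linked_col.
case: v w => [b [i j]] [d [k l]] vP wP.
apply: linked_trans (row _ _ _ true vP) _.
apply: linked_trans (col _ _ true _) _.
exact: linked_sym (row _ _ _ _ wP).
Qed.

End BrickWall.

(** * The hard pairs and the two undefinability results *)

Lemma mp_isomorphic_refl (M : shod_multipede4) : mp_isomorphic M M.
Proof. by exists (fun _ a => a); split=> // s; exists id. Qed.

(** The charges differ only at a haven [v0] for the segment of the shoe, so the zero vector is a
    legal start with that segment as its only pebble. *)
Lemma indistinguishable_multipedes N :
  exists M M' : shod_multipede4, ~ mp_isomorphic M M' /\
  exists (S : bf_system (mp_pair (M, M)) (mp_pair (M, M')) N.+1) (p : cond S),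
    rank S p = 1.
Proof.
pose s0 : wall_seg N.+1 := (None, (ord0, ord0)).
have [|v0 hv0] := @wall_haven_ex N.+1 [set first_seg s0].
  by rewrite cards1.
pose c (v : wall_hyp N.+1) := false; pose c' v := v == v0.
pose M c := inc_multipede (@card_wall_inc N.+1) (@wall_inc_inj N.+1) s0 c.
exists (M c), (M c'); split.
  (* The boundaries sum to [false], the charge differences to [true] because of [v0]. *)
  case/inc_isomorphic_boundary=> x dx; have := wall_boundary_sum x.
  rewrite (eq_bigr _ (fun v _ => dx v)) (bigD1 v0) //= /c' eqxx big1 //.
  by move=> v /negPf ->.
pose S := @bf_twist _ _ _ (@card_wall_inc N.+1) (@wall_inc_inj N.+1) s0 c c'
  _ _ (@wall_haven_open N.+1) (@wall_haven_sub N.+1)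
  (@wall_haven_ex N.+1) (@wall_haven_linked N.+1).
have good : good_twist (@wall_inc N.+1) s0 c c' (@wall_haven N.+1)
    ([set first_seg s0], fun _ => false).
  split=> /=; [exact: set11 | by [] | exists v0 => // u].
  by rewrite addbb /boundary big1_eq.
exists (bf_pair (mp_structure (M c)) S), (exist _ _ good).
exact: cards1.
Qed.

Theorem mainTheorem6 :
  ~ Comega_definable mp_pair (fun MN => mp_isomorphic MN.1 MN.2) /\
  ~ FPCard_definable mp_pair (fun MN => mp_isomorphic MN.1 MN.2).
Proof.
split.
  case=> k [phi [_ defQ]].
  (* One pebble per variable of each sort, one for the shoe, and one spare because the bound on the
     rank is strict. *)
  have [M [M' [nonIso [S [p rkp]]]]] :=
    indistinguishable_multipedes (#|sort (pair_sig mp_sig)| * k).+1.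
  apply: nonIso; apply/(defQ (M, M')).
  apply: (cmodels_invariant (S := S) (p0 := p)); first by rewrite rkp add1n.
  by apply/(defQ (M, M)); apply: mp_isomorphic_refl.
case=> phi [closed defQ].
have [M [M' [nonIso [S [p rkp]]]]] :=
  indistinguishable_multipedes (fdepth phi).+1.
apply: nonIso; apply/(defQ (M, M')).
apply: (fmodels_invariant (S := S) (p := p)) => //; first by rewrite rkp add1n.
by apply/(defQ (M, M)); apply: mp_isomorphic_refl.
Qed.
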